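(* Let $\mathbf{A}\in\mathbb{R}^{m\times n}$ have all rows nonzero, let $b\in\mathcal{R}(\mathbf{A})$, and let $f:\mathbb{R}^n\to\mathbb{R}$ be finite everywhere and $1$-strongly convex. Let $\hat x$ be the unique solution of $\min_x f(x)$ subject to $\mathbf{A}x=b$. Fix a partition of the rows into $M$ blocks and $\alpha\in[0,1]$. Consider the block Bregman–Kaczmarz method (BK): $d^0=0\in\mathbb{R}^n$, $x^0=\nabla f^*(d^0)$, and for $k\ge 0$, choose a block index $i=i_k\in[M]$ at random, independently of the past, with probability $p_i=L_i^\alpha/\sum_{j=1}^M L_j^\alpha$, and set $$d^{k+1}=d^k-\frac{1}{\|\mathbf{A}_{(i)}\|_2^2}\mathbf{A}_{(i)}^\top\big(\mathbf{A}_{(i)}x^k-b_{(i)}\big),\qquad x^{k+1}=\nabla f^*(d^{k+1}).$$ Then for all $k\ge 0$, $$\tfrac12\mathbb{E}\big[\|x^k-\hat x\|_2^2\big]\le \mathbb{E}\big[D_f^{d^k}(x^k,\hat x)\big]\le \frac{2M\bar L_\alpha}{k+4}\,R_{1-\alpha}^2(y^0),$$ where $y^0=0\in\mathbb{R}^m$.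
   Context: Block notation: the index set $[m]$ is partitioned into $M$ consecutive blocks of sizes $m_1,\dots,m_M$ ($\sum_i m_i=m$); writing $\mathbf{I}_m=(\mathbf{U}_1,\dots,\mathbf{U}_M)$ with $\mathbf{U}_i\in\mathbb{R}^{m\times m_i}$, set $\mathbf{A}_{(i)}=\mathbf{U}_i^\top\mathbf{A}$ (the $i$-th row block), $b_{(i)}=\mathbf{U}_i^\top b$, $y_{(i)}=\mathbf{U}_i^\top y$. $L_i=\|\mathbf{A}_{(i)}\|_2^2$ (squared spectral norm), $\bar L_\alpha=\frac1M\sum_{j=1}^M L_j^\alpha$. $f^*$ is the Fenchel conjugate $f^*(x^* )=\sup_y\langle x^*,y\rangle-f(y)$ (differentiable with $1$-Lipschitz gradient). For $x^*\in\partial f(x)$, $D_f^{x^*}(x,y)=f(y)-f(x)-\langle x^*,y-x\rangle$ (Bregman distance). The dual function is $\Psi(y)=f^*(\mathbf{A}^\top y)-b^\top y$ on $\mathbb{R}^m$, with nonempty set of minimizers $\mathcal{Y}^*$. For $\beta\in[0,1]$, $\|y\|_\beta^2=\sum_{i=1}^M L_i^\beta\|y_{(i)}\|_2^2$ and $R_\beta(y^0)=\max_y\{\min_{\hat y\in\mathcal{Y}^*}\|y-\hat y\|_\beta:\ \Psi(y)\le\Psi(y^0)\}$. Expectations are over the random block indices. *)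

(* Defs.v *)
From HB Require Import structures.
From mathcomp Require Import all_boot all_order all_algebra.
From mathcomp Require Import all_classical all_reals all_analysis.
Set Implicit Arguments. Unset Strict Implicit. Unset Printing Implicit Defensive.
Import Order.TTheory GRing.Theory Num.Theory.
Import numFieldNormedType.Exports.
Local Open Scope classical_set_scope.
Local Open Scope ring_scope.

Section Defs.
Variable R : realType.

Definition dot n (x y : 'cV[R]_n) : R := \sum_(i < n) x i 0 * y i 0.
Definition norm2 n (x : 'cV[R]_n) : R := Num.sqrt (dot x x).

Definition specnorm p n (B : 'M[R]_(p, n)) : R :=
  sup [set norm2 (B *m x) | x in [set x : 'cV[R]_n | norm2 x = 1]].

Definition fconj n (f : 'cV[R]_n -> R) (xs : 'cV[R]_n) : R :=
  sup [set dot xs y - f y | y in [set: 'cV[R]_n]].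

Definition strongly_convex1 n (f : 'cV[R]_n -> R) : Prop :=
  forall (x y : 'cV[R]_n) (t : R), 0 <= t <= 1 ->
    f (t *: x + (1 - t) *: y) <=
      t * f x + (1 - t) * f y - t * (1 - t) / 2 * norm2 (x - y) ^+ 2.

Definition is_gradient n (h : 'cV[R]_n -> R) (g : 'cV[R]_n -> 'cV[R]_n) : Prop :=
  forall d, differentiable h d /\ ('d h d : 'cV[R]_n -> R) = (fun v => dot (g d) v).

Definition bregman n (f : 'cV[R]_n -> R) (xs x y : 'cV[R]_n) : R :=
  f y - f x - dot xs (y - x).

(* Block structure: M consecutive blocks of sizes msz i *)
Definition blk_off M (msz : 'I_M -> nat) (i : 'I_M) : nat :=
  (\sum_(j < M | (j < i)%N) msz j)%N.

(* U_i in R^{m x m_i} : columns of I_m belonging to block i *)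
Definition Ublk m M (msz : 'I_M -> nat) (i : 'I_M) : 'M[R]_(m, msz i) :=
  \matrix_(r < m, c < msz i) (((r : nat) == blk_off msz i + c)%N)%:R.

Definition Ablk m n M (msz : 'I_M -> nat) (A : 'M[R]_(m, n)) (i : 'I_M)
  : 'M[R]_(msz i, n) := (Ublk m msz i)^T *m A.

Definition Lblk m n M (msz : 'I_M -> nat) (A : 'M[R]_(m, n)) (i : 'I_M) : R :=
  specnorm (Ablk msz A i) ^+ 2.

Definition Lbar m n M (msz : 'I_M -> nat) (A : 'M[R]_(m, n)) (alpha : R) : R :=
  (M%:R)^-1 * \sum_(j < M) (Lblk msz A j) `^ alpha.

Definition pblk m n M (msz : 'I_M -> nat) (A : 'M[R]_(m, n)) (alpha : R)
  (i : 'I_M) : R :=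
  (Lblk msz A i) `^ alpha / \sum_(j < M) (Lblk msz A j) `^ alpha.

Definition normb m n M (msz : 'I_M -> nat) (A : 'M[R]_(m, n)) (beta : R)
  (y : 'cV[R]_m) : R :=
  Num.sqrt (\sum_(i < M) (Lblk msz A i) `^ beta *
                          norm2 ((Ublk m msz i)^T *m y) ^+ 2).

Definition Psi m n (f : 'cV[R]_n -> R) (A : 'M[R]_(m, n)) (b : 'cV[R]_m)
  (y : 'cV[R]_m) : R := fconj f (A^T *m y) - dot b y.

Definition Ystar m n (f : 'cV[R]_n -> R) (A : 'M[R]_(m, n)) (b : 'cV[R]_m)
  : set 'cV[R]_m := [set y | forall z, Psi f A b y <= Psi f A b z].

Definition Rbeta m n M (msz : 'I_M -> nat) (f : 'cV[R]_n -> R)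
  (A : 'M[R]_(m, n)) (b : 'cV[R]_m) (beta : R) (y0 : 'cV[R]_m) : \bar R :=
  ereal_sup [set ereal_inf [set (normb msz A beta (y - yh))%:E
                             | yh in Ystar f A b]
            | y in [set y | Psi f A b y <= Psi f A b y0]].

Definition bk_step m n M (msz : 'I_M -> nat) (A : 'M[R]_(m, n)) (b : 'cV[R]_m)
  (gradf : 'cV[R]_n -> 'cV[R]_n) (d : 'cV[R]_n) (i : 'I_M) : 'cV[R]_n :=
  d - (Lblk msz A i)^-1 *:
      ((Ablk msz A i)^T *m (Ablk msz A i *m gradf d - (Ublk m msz i)^T *m b)).

(* d^k for the index sequence s = (i_0, ..., i_{k-1}), started at d^0 = 0 *)
Definition bk_d m n M (msz : 'I_M -> nat) (A : 'M[R]_(m, n)) (b : 'cV[R]_m)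
  (gradf : 'cV[R]_n -> 'cV[R]_n) (s : seq 'I_M) : 'cV[R]_n :=
  foldl (bk_step msz A b gradf) 0 s.

(* expectation over k i.i.d. block indices with law p *)
Definition Eblk M (p : 'I_M -> R) (k : nat) (X : seq 'I_M -> R) : R :=
  \sum_(s : k.-tuple 'I_M) (\prod_(j < k) p (tnth s j)) * X (val s).

End Defs.

(* Main.v *)
(* The iterates are d^k = A^T y^k, where y^k is randomized block coordinate
   descent on the dual function Psi, and the Bregman distance to xhat is the dual
   gap Psi(y^k) - min Psi. A step on block i decreases Psi by at least
   |grad_i|^2 / (2 L_i), so the expected decrease is the squared dual norm of the
   gradient divided by 2 S, S = sum_j L_j^alpha. Convexity bounds the gap by that
   dual norm times R_{1-alpha}, which gives, with Jensen,
   gap_k^2 <= 2 S R^2 (gap_k - gap_{k+1}); smoothness gives gap_0 <= S R^2 / 2,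
   and the rate follows by induction on k.

   The smoothness of the conjugate is derived from the fact that its gradient at d
   attains the supremum defining it. *)

Require Import Defs.
From HB Require Import structures.
From mathcomp Require Import all_boot all_order all_algebra.
From mathcomp Require Import all_classical all_reals all_analysis.
From mathcomp Require Import ring lra.
Import Order.TTheory GRing.Theory Num.Theory.
Import numFieldNormedType.Exports.
Local Open Scope classical_set_scope.
Local Open Scope ring_scope.

(** * Weighted Cauchy-Schwarz and Euclidean geometry *)

(** The sum of (a_i - t w_i b_i)^2 / w_i is a nonnegative quadratic in t, so its discriminant is at
    most 0. *)
Lemma weighted_Cauchy_Schwarz {R : realType} {I : finType} (w a b : I -> R) :
  (forall i, 0 < w i) ->
  (\sum_i a i * b i) ^+ 2 <=
    (\sum_i a i ^+ 2 / w i) * (\sum_i w i * b i ^+ 2).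
Proof.
move=> w_gt0.
set P := \sum_i a i ^+ 2 / w i; set Q := \sum_i w i * b i ^+ 2.
set D := \sum_i a i * b i.
have quad t : 0 <= P - 2 * t * D + t ^+ 2 * Q.
  rewrite /P /D /Q !mulr_sumr -sumrB -big_split /=.
  apply: sumr_ge0 => i _.
  have -> : a i ^+ 2 / w i - 2 * t * (a i * b i) + t ^+ 2 * (w i * b i ^+ 2)
    = (a i - t * w i * b i) ^+ 2 / w i by field; rewrite gt_eqF.
  by rewrite divr_ge0 ?sqr_ge0 // ltW.
have : 0 <= Q by apply: sumr_ge0 => i _; rewrite mulr_ge0 ?sqr_ge0 // ltW.
rewrite le_eqVlt => /predU1P[Q0|Q_gt0].
  rewrite -Q0 mulr0; have [->|D0] := eqVneq D 0; first by rewrite expr0n.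
  have := quad ((P + 1) / (2 * D)); rewrite -Q0 mulr0 addr0.
  have -> : P - 2 * ((P + 1) / (2 * D)) * D = -1 by field.
  by rewrite ler0N1.
have := quad (D / Q).
have -> : P - 2 * (D / Q) * D + (D / Q) ^+ 2 * Q = (P * Q - D ^+ 2) / Q.
  by field; rewrite gt_eqF.
by rewrite pmulr_lge0 ?invr_gt0 // subr_ge0.
Qed.

Lemma dotC {R : realType} {n} (x y : 'cV[R]_n) : dot x y = dot y x.
Proof. by apply: eq_bigr => i _; rewrite mulrC. Qed.

Lemma dotDl {R : realType} {n} (x y z : 'cV[R]_n) :
  dot (x + y) z = dot x z + dot y z.
Proof. by rewrite -big_split; apply: eq_bigr => i _; rewrite mxE mulrDl. Qed.

Lemma dotZl {R : realType} {n} (a : R) (x z : 'cV[R]_n) :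
  dot (a *: x) z = a * dot x z.
Proof. by rewrite mulr_sumr; apply: eq_bigr => i _; rewrite mxE mulrA. Qed.

Lemma dotNl {R : realType} {n} (x z : 'cV[R]_n) : dot (- x) z = - dot x z.
Proof. by rewrite -scaleN1r dotZl mulN1r. Qed.

Lemma dotBl {R : realType} {n} (x y z : 'cV[R]_n) :
  dot (x - y) z = dot x z - dot y z.
Proof. by rewrite dotDl dotNl. Qed.

Lemma dotDr {R : realType} {n} (z x y : 'cV[R]_n) :
  dot z (x + y) = dot z x + dot z y.
Proof. by rewrite !(dotC z) dotDl. Qed.

Lemma dotZr {R : realType} {n} (a : R) (z x : 'cV[R]_n) :
  dot z (a *: x) = a * dot z x.
Proof. by rewrite !(dotC z) dotZl. Qed.

Lemma dotNr {R : realType} {n} (z x : 'cV[R]_n) : dot z (- x) = - dot z x.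
Proof. by rewrite !(dotC z) dotNl. Qed.

Lemma dotBr {R : realType} {n} (z x y : 'cV[R]_n) :
  dot z (x - y) = dot z x - dot z y.
Proof. by rewrite !(dotC z) dotBl. Qed.

Lemma dot0l {R : realType} {n} (z : 'cV[R]_n) : dot 0 z = 0.
Proof. by rewrite -(scale0r 0) dotZl mul0r. Qed.

Lemma dot_sumr {R : realType} {n} {I : finType} (z : 'cV[R]_n)
    (x : I -> 'cV[R]_n) :
  dot z (\sum_i x i) = \sum_i dot z (x i).
Proof.
apply: (big_morph (dot z)); first exact: dotDr.
by rewrite dotC dot0l.
Qed.

Lemma dot_mulmx {R : realType} {p n} (B : 'M[R]_(p, n)) x y :
  dot (B *m x) y = dot x (B^T *m y).
Proof.
rewrite /dot.
under eq_bigr do rewrite mxE mulr_suml.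
rewrite exchange_big /=; apply: eq_bigr => j _.
rewrite mxE mulr_sumr; apply: eq_bigr => i _; rewrite !mxE.
by rewrite -mulrA mulrCA.
Qed.

Lemma dot_ge0 {R : realType} {n} (x : 'cV[R]_n) : 0 <= dot x x.
Proof. by apply: sumr_ge0 => i _; rewrite -expr2 sqr_ge0. Qed.

Lemma norm2_ge0 {R : realType} {n} (x : 'cV[R]_n) : 0 <= norm2 x.
Proof. exact: sqrtr_ge0. Qed.

Lemma sqr_norm2 {R : realType} {n} (x : 'cV[R]_n) : norm2 x ^+ 2 = dot x x.
Proof. by rewrite sqr_sqrtr // dot_ge0. Qed.

Lemma dot_eq0 {R : realType} {n} (x : 'cV[R]_n) : dot x x = 0 -> x = 0.
Proof.
move/eqP; rewrite psumr_eq0 => [/allP x0|i _]; last by rewrite -expr2 sqr_ge0.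
apply/colP => i; rewrite mxE; apply/eqP.
by have := x0 i (mem_index_enum _); rewrite mulf_eq0 orbb.
Qed.

Lemma norm2Z {R : realType} {n} (a : R) (x : 'cV[R]_n) :
  norm2 (a *: x) = `|a| * norm2 x.
Proof.
by rewrite /norm2 dotZl dotZr mulrA -expr2 sqrtrM ?sqr_ge0 // sqrtr_sqr.
Qed.

Lemma norm2N {R : realType} {n} (x : 'cV[R]_n) : norm2 (- x) = norm2 x.
Proof. by rewrite -scaleN1r norm2Z normrN1 mul1r. Qed.

Lemma norm20 {R : realType} {n} : norm2 (0 : 'cV[R]_n) = 0.
Proof. by rewrite /norm2 dot0l sqrtr0. Qed.

Lemma norm2_eq0 {R : realType} {n} (x : 'cV[R]_n) : norm2 x = 0 -> x = 0.
Proof. by move=> x0; apply: dot_eq0; rewrite -sqr_norm2 x0 expr0n. Qed.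

Lemma dot_le_norm2 {R : realType} {n} (x y : 'cV[R]_n) :
  dot x y <= norm2 x * norm2 y.
Proof.
apply: le_trans (ler_norm _) _.
rewrite -(ler_pXn2r (_ : 0 < 2)%N) ?nnegrE ?mulr_ge0 ?norm2_ge0 //.
rewrite real_normK ?num_real // exprMn !sqr_norm2.
have := @weighted_Cauchy_Schwarz R 'I_n (fun=> 1) (x^~ 0) (y^~ 0) (fun=> ltr01).
congr (_ <= _ * _); apply: eq_bigr => i _; first by rewrite divr1 expr2.
by rewrite mul1r expr2.
Qed.

Lemma coord_le_norm2 {R : realType} {n} (x : 'cV[R]_n) i : `|x i 0| <= norm2 x.
Proof.
rewrite -(ler_pXn2r (_ : 0 < 2)%N) ?nnegrE ?norm2_ge0 //.
rewrite real_normK ?num_real // sqr_norm2 /dot (bigD1 i) //= expr2 lerDl.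
by apply: sumr_ge0 => j _; rewrite -expr2 sqr_ge0.
Qed.

Lemma mx_norm_le_norm2 {R : realType} {n} (x : 'cV[R]_n) : `|x| <= norm2 x.
Proof.
rewrite [`|x|]mx_normrE; apply/bigmax_leP; split; first exact: norm2_ge0.
by case=> i j _ /=; rewrite (ord1 j) coord_le_norm2.
Qed.

(** * Bounds for finite strongly convex functions *)

Lemma strongly_convex1_convex {R : realType} {n} {f : 'cV[R]_n -> R} x y {t} :
  strongly_convex1 f -> 0 <= t <= 1 ->
  f (t *: x + (1 - t) *: y) <= t * f x + (1 - t) * f y.
Proof.
move=> scf t01; apply: le_trans (scf x y t t01) _.
rewrite gerBl; case/andP: t01 => t0 t1.
by rewrite mulr_ge0 ?sqr_ge0 // mulr_ge0 ?invr_ge0 // mulr_ge0 // subr_ge0.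
Qed.

Lemma strongly_convex1_tilt {R : realType} {n} {f : 'cV[R]_n -> R} d :
  strongly_convex1 f -> strongly_convex1 (fun y => f y - dot d y).
Proof.
move=> scf x y t t01; have := scf x y t t01.
by rewrite dotDr !dotZr; lra.
Qed.

Lemma convex_le_max {R : realType} {n} {f : 'cV[R]_n -> R} x v {a} :
  strongly_convex1 f -> `|a| <= 1 ->
  f (x + a *: v) <= Num.max (f (x + v)) (f (x - v)).
Proof.
move=> scf; rewrite ler_norml => /andP[a_ge a_le].
have t01 : 0 <= (1 + a) / 2 <= 1 by lra.
have -> : x + a *: v =
    ((1 + a) / 2) *: (x + v) + (1 - (1 + a) / 2) *: (x - v).
  by apply/colP => i; rewrite !mxE; field.
apply: le_trans (strongly_convex1_convex _ _ scf t01) _.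
set m := Num.max _ _.
have fl : f (x + v) <= m by rewrite le_max lexx.
have fr : f (x - v) <= m by rewrite le_max lexx orbT.
by nra.
Qed.

(** Convexity pushes each coordinate in turn to an endpoint of [-1, 1], so the vertices of a cube
    bound f. The centre [x] stays general because the induction shifts it. *)
Lemma convex_bounded_box {R : realType} {n} {f : 'cV[R]_n -> R} (s : seq 'I_n) :
  strongly_convex1 f -> forall x, exists C, forall a : 'I_n -> R,
    (forall i, `|a i| <= 1) -> f (x + \sum_(i <- s) a i *: delta_mx i 0) <= C.
Proof.
move=> scf; elim: s => [|i s IHs] x.
  by exists (f x) => a _; rewrite big_nil addr0.
have [C1 HC1] := IHs (x + delta_mx i 0); have [C2 HC2] := IHs (x - delta_mx i 0).
exists (Num.max C1 C2) => a a1; rewrite big_cons addrCA addrC.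
apply: le_trans (convex_le_max _ _ scf (a1 i)) _.
by rewrite ge_max !le_max (addrAC x) HC1 // (addrAC x _ (- _)) HC2 // orbT.
Qed.

Lemma convex_bounded_ball {R : realType} {n} {f : 'cV[R]_n -> R} x :
  strongly_convex1 f -> exists C, forall h, norm2 h <= 1 -> f (x + h) <= C.
Proof.
move=> scf; have [C HC] := convex_bounded_box (index_enum 'I_n) scf x.
exists C => h h1; have := HC (h^~ 0).
have <- : h = \sum_i h i 0 *: delta_mx i 0.
  rewrite [LHS]matrix_sum_delta; apply: eq_bigr => i _.
  by rewrite big_ord_recl big_ord0 addr0.
by apply => i; apply: le_trans (coord_le_norm2 _ _) h1.
Qed.

(** The point [x] lies between [u] and the point at unit distance from [x] on the opposite side; an
    upper bound for f there gives a lower bound at [u]. *)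
Lemma convex_lsc {R : realType} {n} {f : 'cV[R]_n -> R} x :
  strongly_convex1 f -> exists2 K, 0 <= K &
    forall u, norm2 (u - x) <= 1 -> f x - K * norm2 (u - x) <= f u.
Proof.
move=> scf; have [C HC] := convex_bounded_ball x scf.
have K0 : 0 <= C - f x.
  rewrite subr_ge0; have := HC 0; rewrite addr0; apply.
  by rewrite norm20.
exists (C - f x) => // u u1; set r := norm2 (u - x).
have [r0|r_gt0] := eqVneq r 0.
  have -> : u = x.
    by apply/eqP; rewrite -subr_eq0; apply/eqP/norm2_eq0.
  by rewrite r0 mulr0 subr0.
have {}r_gt0 : 0 < r by rewrite lt_def r_gt0 norm2_ge0.
have r1 : 1 + r != 0 by rewrite gt_eqF // addr_gt0.
have t01 : 0 <= (1 + r)^-1 <= 1.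
  by rewrite invr_ge0 invf_le1 ?addr_gt0 //; lra.
have := strongly_convex1_convex u (x + (- r^-1) *: (u - x)) scf t01.
have -> : (1 + r)^-1 *: u + (1 - (1 + r)^-1) *: (x + (- r^-1) *: (u - x)) = x.
  by apply/colP => i; rewrite !mxE; field; rewrite r1 gt_eqF.
have := HC ((- r^-1) *: (u - x)).
rewrite norm2Z -/r normrN normfV (gtr0_norm r_gt0) mulVf ?gt_eqF //.
move/(_ (lexx _)); set fz := f (x + _) => fzC fx.
have : (1 + r) * f x <= f u + r * fz.
  rewrite -ler_pdivlMl ?addr_gt0 //; apply: le_trans fx _.
  by rewrite le_eqVlt; apply/orP; left; apply/eqP; field.
by nra.
Qed.

(* The quadratic growth of [g] away from 0 beats the linear decrease allowed by
   its lower bound on the unit ball. *)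
Lemma strongly_convex1_lower_bound {R : realType} {n} {g : 'cV[R]_n -> R} :
  strongly_convex1 g -> exists m, forall y, m <= g y.
Proof.
move=> scg; have [C HC] := convex_bounded_ball 0 scg.
have {}HC h : norm2 h <= 1 -> g h <= C by move/HC; rewrite add0r.
(* Midpoint convexity at 0 turns the upper bound at -h into a lower bound at h. *)
have ball h : norm2 h <= 1 -> 2 * g 0 - C <= g h.
  move=> h1; have t01 : 0 <= (2^-1 : R) <= 1 by lra.
  have := strongly_convex1_convex h (- h) scg t01.
  have -> : 2^-1 *: h + (1 - 2^-1) *: (- h) = 0.
    by apply/colP => i; rewrite !mxE; field.
  have := HC (- h); rewrite norm2N => /(_ h1).
  by lra.
have K0 : g 0 <= C by apply: HC; rewrite norm20.
(* With K = C - g 0, the lower bound outside the ball is g 0 - (K + 1/2) r + r^2 / 2, which stays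
   above this constant for every r. *)
exists (g 0 - (C - g 0 + 1) ^+ 2) => y.
have [y1|y1] := leP (norm2 y) 1; first by have := ball y y1; nra.
set r := norm2 y in y1; have r0 : 0 < r by apply: lt_trans y1.
have t01 : 0 <= r^-1 <= 1 by rewrite invr_ge0 invf_le1 // !ltW.
have := scg y 0 r^-1 t01.
rewrite scaler0 addr0 subr0 -/r.
have := ball (r^-1 *: y).
rewrite norm2Z -/r normfV (gtr0_norm r0) mulVf ?gt_eqF // => /(_ (lexx _)) lo up.
have {up lo} := le_trans lo up.
rewrite -(ler_pM2l r0).
have -> : r * (r^-1 * g y + (1 - r^-1) * g 0 - r^-1 * (1 - r^-1) / 2 * r ^+ 2)
   = g y + (r - 1) * g 0 - r * (r - 1) / 2 by field; rewrite gt_eqF.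
have := sqr_ge0 (r - (C - g 0 + 1 / 2)); have := sqr_ge0 (C - g 0).
by nra.
Qed.

(** * The conjugate: attainment, convexity and smoothness *)

(** The real [sup] has its meaning only on nonempty sets bounded above; this makes [fconj] the true
    conjugate. *)
Lemma fconj_has_sup {R : realType} {n} {f : 'cV[R]_n -> R} d :
  strongly_convex1 f -> has_sup [set dot d y - f y | y in [set: 'cV[R]_n]].
Proof.
move=> scf; split; first by exists (dot d 0 - f 0); exists 0.
have [m Hm] := strongly_convex1_lower_bound (strongly_convex1_tilt d scf).
by exists (- m) => _ [y _ <-]; have := Hm y; lra.
Qed.

Lemma Fenchel_Young {R : realType} {n} {f : 'cV[R]_n -> R} d y :
  strongly_convex1 f -> dot d y - f y <= fconj f d.
Proof.
by move=> scf; apply: ub_le_sup; [case: (fconj_has_sup d scf)|exists y].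
Qed.

Lemma fconj_expansion {R : realType} {n} {f : 'cV[R]_n -> R} {g} d {eps : R} :
  is_gradient (fconj f) g -> 0 < eps -> exists2 delta, 0 < delta &
    forall h, norm2 h <= delta ->
      fconj f (d + h) <= fconj f d + dot (g d) h + eps * norm2 h.
Proof.
move=> /(_ d)[df dfE] eps0.
have [rm rmE] : exists rm : {o_ (nbhs (0 : 'cV[R]_n)) (@idfun 'cV[R]_n)},
    forall h, fconj f (d + h) = fconj f d + 'd (fconj f) d h + rm h.
  by eexists => h; rewrite (diff_locallyxC df).
have /nbhs_ballP[e /= e0 He] := littleoP rm eps0.
exists (e / 2); first by rewrite divr_gt0.
move=> h he; rewrite rmE dfE lerD2l.
apply: le_trans (ler_norm _) _; apply: le_trans (He h _) _ => /=.
  rewrite -ball_normE /= sub0r normrN.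
  apply: le_lt_trans (mx_norm_le_norm2 h) _; apply: le_lt_trans he _.
  by lra.
by rewrite ler_pM2l // mx_norm_le_norm2.
Qed.

(* Testing differentiability of the conjugate in the direction [u - g d] forces
   every near-maximizer [u] to be close to [g d]; no compactness is needed. *)
Lemma near_maximizer_close {R : realType} {n} {f : 'cV[R]_n -> R} {g} d {eta : R} :
  strongly_convex1 f -> is_gradient (fconj f) g -> 0 < eta ->
  exists2 u, norm2 (u - g d) <= eta & f u <= dot d u - fconj f d + eta.
Proof.
move=> scf gradg eta0.
have eta2 : 0 < eta / 2 by rewrite divr_gt0.
have [delta delta0 Hdelta] := fconj_expansion d gradg eta2.
(* A test direction of length delta will give delta * r < delta * eta / 2 + eps, which contradicts r
   > eta for this eps. *)
pose eps := Num.min eta (delta * eta / 2).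
have eps0 : 0 < eps by rewrite lt_min eta0 divr_gt0 // mulr_gt0.
have [_ [u _ <-] Hu] := sup_adherent eps0 (fconj_has_sup d scf).
rewrite -/(fconj f d) in Hu.
have eps1 : eps <= eta by rewrite ge_min lexx.
have eps2 : eps <= delta * eta / 2 by rewrite ge_min lexx orbT.
exists u; last by lra.
set r := norm2 (u - g d); rewrite leNgt; apply/negP => r_gt.
have r0 : 0 < r by apply: lt_trans r_gt.
have nh : norm2 ((delta / r) *: (u - g d)) = delta.
  by rewrite norm2Z -/r gtr0_norm ?divr_gt0 // divfK // gt_eqF.
have := Hdelta ((delta / r) *: (u - g d)); rewrite nh => /(_ (lexx _)).
have := Fenchel_Young (d + (delta / r) *: (u - g d)) u scf.
set h := _ *: _ => lo up.
have : dot h (u - g d) = delta * r.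
  by rewrite dotZl -sqr_norm2 -/r; field; rewrite gt_eqF.
rewrite dotBr; rewrite dotDl in lo; rewrite (dotC (g d)) in up.
by nra.
Qed.

(** Near-maximizers exist arbitrarily close to [g d], and lower semicontinuity of f there carries
    the supremum over to [g d]. *)
Lemma fconj_grad {R : realType} {n} {f : 'cV[R]_n -> R} {g} d :
  strongly_convex1 f -> is_gradient (fconj f) g ->
  fconj f d = dot d (g d) - f (g d).
Proof.
move=> scf gradg; apply/le_anti/andP; split; last exact: Fenchel_Young.
rewrite leNgt; apply/negP => gap.
have [K K0 HK] := convex_lsc (g d) scf.
pose c := fconj f d - (dot d (g d) - f (g d)).
have c0 : 0 < c by rewrite subr_gt0.
(* The errors from near-maximality, from [convex_lsc] and from dot d u total at most eta * (1 + K +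
   norm2 d), to be kept below the supposed gap c. *)
pose N := 2 + K + norm2 d; have N0 : 0 < N.
  by rewrite /N; have := norm2_ge0 d; lra.
have eta0 : 0 < Num.min 1 (c / (2 * N)).
  by rewrite lt_min ltr01 divr_gt0 // mulr_gt0.
have [u] := near_maximizer_close d scf gradg eta0.
set eta := Num.min _ _ in eta0 *; set r := norm2 _ => r_le fu.
have eta1 : eta <= 1 by rewrite ge_min lexx.
have etaN : eta * N <= c / 2.
  have : eta <= c / (2 * N) by rewrite ge_min lexx orbT.
  by rewrite ler_pdivlMr ?mulr_gt0 //; lra.
have := HK u (le_trans r_le eta1); rewrite -/r => fx.
have := dot_le_norm2 d (u - g d); rewrite dotBr -/r => du.
have Kr : K * r <= K * eta by rewrite ler_wpM2l.
have dr : norm2 d * r <= norm2 d * eta by rewrite ler_wpM2l ?norm2_ge0.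
by rewrite /N /c in etaN c0; nra.
Qed.

(** Strong convexity along the segment from [g d], the minimizer of f - dot d, to [y] gives the
    estimate up to a factor 1 - t, removed by taking t small. *)
Lemma tilt_growth {R : realType} {n} {f : 'cV[R]_n -> R} {g} d y :
  strongly_convex1 f -> is_gradient (fconj f) g ->
  norm2 (g d - y) ^+ 2 / 2 <= fconj f d + f y - dot d y.
Proof.
move=> scf gradg; set N := norm2 _ ^+ 2.
set G := fconj f d + f y - dot d y.
have N0 : 0 <= N by rewrite sqr_ge0.
have line t : 0 < t <= 1 -> (1 - t) * (N / 2) <= G.
  case/andP=> t0 t1; have t01 : 0 <= 1 - t <= 1 by lra.
  have := strongly_convex1_tilt d scf (g d) y _ t01.
  have := Fenchel_Young d ((1 - t) *: g d + (1 - (1 - t)) *: y) scf.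
  rewrite (fconj_grad d scf gradg) -/N => lo up.
  rewrite -(ler_pM2l t0) /G (fconj_grad d scf gradg); nra.
rewrite leNgt; apply/negP => GN.
have N20 : 0 < N / 2.
  by have := line 1; rewrite subrr mul0r ltr01 lexx => /(_ isT) G0; lra.
(* For t up to this value, (1 - t) * (N / 2) is at least the mean of N / 2 and G, hence exceeds
   G. *)
have t0 : 0 < (N / 2 - G) / N by rewrite divr_gt0 ?subr_gt0; lra.
have := line (Num.min 1 ((N / 2 - G) / N)).
rewrite lt_min ltr01 t0 ge_min lexx => /(_ isT).
set t := Num.min _ _.
have : t <= (N / 2 - G) / N by rewrite ge_min lexx orbT.
by rewrite ler_pdivlMr; [lra|lra].
Qed.

Lemma fconj_convex {R : realType} {n} {f : 'cV[R]_n -> R} {g} d e :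
  strongly_convex1 f -> is_gradient (fconj f) g ->
  fconj f d + dot (e - d) (g d) <= fconj f e.
Proof.
move=> scf gradg; have := Fenchel_Young e (g d) scf.
by rewrite (fconj_grad d scf gradg) dotBl; lra.
Qed.

(** Each y in the supremum is bounded separately: with w = g d - y, quadratic growth absorbs the
    cross term - dot h w through the square of h + w. *)
Lemma fconj_descent {R : realType} {n} {f : 'cV[R]_n -> R} {g} d h :
  strongly_convex1 f -> is_gradient (fconj f) g ->
  fconj f (d + h) <= fconj f d + dot h (g d) + norm2 h ^+ 2 / 2.
Proof.
move=> scf gradg; apply: ge_sup; first by exists (dot (d + h) 0 - f 0); exists 0.
move=> _ [y _ <-].
have := tilt_growth d y scf gradg.
have := dot_ge0 (h + (g d - y)); have := dotBr h (g d) y.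
rewrite !sqr_norm2 (dotDl d); move: (g d - y) => w.
by rewrite dotDl !dotDr (dotC w h); lra.
Qed.

(** * The spectral norm *)

Lemma specnorm_has_ubound {R : realType} {p n} (B : 'M[R]_(p, n)) :
  has_ubound [set norm2 (B *m x) | x in [set x : 'cV[R]_n | norm2 x = 1]].
Proof.
exists (Num.sqrt (\sum_(i < p) norm2 (row i B)^T ^+ 2)) => _ [x /= x1 <-].
rewrite ler_wsqrtr //; apply: ler_sum => i _; rewrite -expr2.
have -> : (B *m x) i 0 = dot (row i B)^T x.
  by rewrite mxE; apply: eq_bigr => j _; rewrite !mxE.
rewrite -[leLHS]real_normK ?num_real // ler_sqr ?nnegrE ?norm2_ge0 //.
rewrite ler_norml; have := dot_le_norm2 (row i B)^T x.
have := dot_le_norm2 (row i B)^T (- x).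
by rewrite dotNr norm2N x1 mulr1; lra.
Qed.

Lemma norm2_mulmx {R : realType} {p n} (B : 'M[R]_(p, n)) x :
  norm2 (B *m x) <= specnorm B * norm2 x.
Proof.
have [/norm2_eq0 ->|x0] := eqVneq (norm2 x) 0.
  by rewrite mulmx0 !norm20 mulr0.
have {}x0 : 0 < norm2 x by rewrite lt_def x0 norm2_ge0.
rewrite -ler_pdivrMr // mulrC.
have -> : (norm2 x)^-1 * norm2 (B *m x) = norm2 (B *m ((norm2 x)^-1 *: x)).
  by rewrite -scalemxAr norm2Z normfV gtr0_norm.
apply: ub_le_sup; first exact: specnorm_has_ubound.
exists ((norm2 x)^-1 *: x) => //=.
by rewrite norm2Z normfV gtr0_norm // mulVf // gt_eqF.
Qed.

Lemma specnorm_ge0 {R : realType} {p n} (B : 'M[R]_(p, n)) : 0 <= specnorm B.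
Proof.
(* For n = 0 there is no unit vector, and [sup] of the empty set is 0. *)
have [B0|/set0P[_ [x x1 _]]] := eqVneq
    [set norm2 (B *m x) | x in [set x : 'cV[R]_n | norm2 x = 1]] set0.
  by rewrite /specnorm B0 sup0.
apply: le_trans (norm2_ge0 (B *m x)) _.
by apply: ub_le_sup; [exact: specnorm_has_ubound|exists x].
Qed.

(** Pairing w = B^T z with itself gives norm2 w ^+ 2 = dot z (B w), to which the bound for B
    applies. *)
Lemma norm2_mulmx_tr {R : realType} {p n} (B : 'M[R]_(p, n)) z :
  norm2 (B^T *m z) <= specnorm B * norm2 z.
Proof.
set w := B^T *m z.
have [->|w0] := eqVneq (norm2 w) 0.
  by rewrite mulr_ge0 ?specnorm_ge0 ?norm2_ge0.
have {}w0 : 0 < norm2 w by rewrite lt_def w0 norm2_ge0.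
rewrite -(ler_pM2r w0) -expr2 sqr_norm2 {2}/w -dot_mulmx.
apply: le_trans (dot_le_norm2 _ _) _.
by rewrite mulrAC ler_wpM2r ?norm2_ge0 // norm2_mulmx.
Qed.

Lemma specnorm_gt0 {R : realType} {p n} (B : 'M[R]_(p, n)) :
  B != 0 -> 0 < specnorm B.
Proof.
move=> B0; rewrite lt_def specnorm_ge0 andbT; apply: contra_neq B0 => s0.
apply/matrixP => i j; have : B *m delta_mx j 0 = 0 :> 'cV[R]_p.
  apply: norm2_eq0; apply/le_anti; rewrite norm2_ge0 andbT.
  by have := norm2_mulmx B (delta_mx j 0); rewrite s0 mul0r.
by rewrite -colE => /colP/(_ i); rewrite !mxE.
Qed.

(** * Decomposition into consecutive blocks *)

Lemma blk_off_nat {M} (msz : 'I_M -> nat) (s : nat -> nat) (i : 'I_M) :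
  (forall j : 'I_M, s j = msz j) ->
  blk_off msz i = (\sum_(0 <= j < i) s j)%N.
Proof.
move=> sE; rewrite /blk_off big_mkord (big_ord_widen M s (ltnW (ltn_ord i))).
by apply: eq_bigr => j _; rewrite sE.
Qed.

Lemma sum_consecutive_blocks {V : nmodType} (s : nat -> nat) (F : nat -> V) M :
  \sum_(0 <= i < M) \sum_(0 <= c < s i) F (\sum_(0 <= j < i) s j + c)%N =
  \sum_(0 <= r < \sum_(0 <= j < M) s j) F r.
Proof.
elim: M => [|M IHM]; first by rewrite !big_geq.
rewrite !big_nat_recr //= IHM.
rewrite [RHS](big_cat_nat (leq0n _) (leq_addr _ _)) /=; congr (_ + _).
set O := (\sum_(0 <= j < M) s j)%N.
have := big_addn 0 (O + s M) O xpredT F (op := +%R) (idx := 0).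
rewrite add0n addKn => ->.
by apply: eq_bigr => c _; rewrite addnC.
Qed.

Lemma sum_blocks {V : nmodType} {M m} (msz : 'I_M -> nat) (F : nat -> V) :
  (\sum_(i < M) msz i)%N = m ->
  \sum_(i < M) \sum_(c < msz i) F (blk_off msz i + c)%N = \sum_(r < m) F r.
Proof.
(* Extending the sizes by 0 to all naturals permits induction on the number of blocks. *)
pose s j := if insub j is Some i then msz i else 0%N.
have sE (j : 'I_M) : s j = msz j by rewrite /s valK.
have <- : (\sum_(j < M) s j)%N = (\sum_(i < M) msz i)%N by apply: eq_bigr.
move=> <-; rewrite -(big_mkord xpredT) -[in RHS](big_mkord xpredT).
rewrite -sum_consecutive_blocks big_mkord; apply: eq_bigr => i _.
by rewrite sE -(blk_off_nat _ _ _ sE) big_mkord.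
Qed.

(** Every index lies in exactly one block, so the sum over blocks and columns collapses to one sum
    of products of Kronecker deltas. *)
Lemma sum_Ublk {R : realType} {M m} (msz : 'I_M -> nat) :
  (\sum_(i < M) msz i)%N = m ->
  \sum_i Ublk R m msz i *m (Ublk R m msz i)^T = 1%:M.
Proof.
move=> szm; apply/matrixP => r s; rewrite summxE mxE.
pose F t : R := ((r : nat) == t)%:R * ((s : nat) == t)%:R.
transitivity (\sum_(i < M) \sum_(c < msz i) F (blk_off msz i + c)%N).
  by apply: eq_bigr => i _; rewrite mxE; apply: eq_bigr => c _; rewrite !mxE.
rewrite (sum_blocks _ _ szm) (bigD1 r) //= big1 => [|t tr].
  by rewrite /F eqxx mul1r addr0 eq_sym.
have -> : F t = (r == t)%:R * (s == t)%:R by [].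
by rewrite eq_sym (negbTE tr) mul0r.
Qed.

Lemma blk_off_bound {M m} (msz : 'I_M -> nat) (i : 'I_M) :
  (\sum_(i < M) msz i)%N = m -> (blk_off msz i + msz i <= m)%N.
Proof.
move=> <-; rewrite (bigID (fun j : 'I_M => (j < i)%N)) /= leq_add2l.
by rewrite (bigD1 i) ?ltnn //= leq_addr.
Qed.

Lemma Lblk_gt0 {R : realType} {M m n} (msz : 'I_M -> nat) (A : 'M[R]_(m, n))
    (i : 'I_M) :
  (0 < msz i)%N -> (\sum_(i < M) msz i)%N = m ->
  (forall r : 'I_m, row r A != 0) -> 0 < Lblk msz A i.
Proof.
move=> szi szm rowA; rewrite exprn_gt0 // specnorm_gt0 //.
have rm : (blk_off msz i < m)%N.
  by apply: leq_trans (blk_off_bound _ i szm); rewrite -addn1 leq_add2l.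
apply: contra (rowA (Ordinal rm)) => /eqP/matrixP Ai0.
apply/eqP/rowP => j; have := Ai0 (Ordinal szi) j.
rewrite !mxE (bigD1 (Ordinal rm)) //= big1 => [|r /eqP neq].
  by rewrite !mxE /= addn0 eqxx mul1r addr0.
rewrite !mxE /= addn0; case: eqP => [rE|]; last by rewrite mul0r.
by case: neq; apply: val_inj.
Qed.

(** * Expectation over block sequences *)

Lemma Eblk0 {R : realType} {M} (p : 'I_M -> R) X : Eblk p 0 X = X [::].
Proof.
rewrite /Eblk (big_pred1 [tuple]) => [|t]; last by rewrite /= tuple0; apply/esym/eqP.
by rewrite big_ord0 mul1r.
Qed.

(** Conditioning on the first k indices: the last one is independent of them, so the weight
    factors. *)
Lemma Eblk_rcons {R : realType} {M} (p : 'I_M -> R) k X :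
  Eblk p k.+1 X = Eblk p k (fun s => \sum_i p i * X (rcons s i)).
Proof.
pose h (si : k.-tuple 'I_M * 'I_M) := [tuple of rcons si.1 si.2].
have h_bij : bijective h.
  apply: inj_card_bij => [[s i] [t j] /(congr1 val) /= /rcons_inj[st ->]|].
    by congr (_, _); apply: val_inj.
  by rewrite card_prod !card_tuple card_ord expnSr.
rewrite /Eblk (reindex h) /=; last exact: onW_bij.
rewrite -(pair_bigA _ (fun (s : k.-tuple 'I_M) i =>
  (\prod_(j < k.+1) p (tnth (h (s, i)) j)) * X (rcons s i))) /=.
apply: eq_bigr => s _; rewrite mulr_sumr; apply: eq_bigr => i _.
rewrite mulrA big_ord_recr /=; congr (_ * p _ * _).
  apply: eq_bigr => j _; congr p.
  by rewrite !(tnth_nth i) /= nth_rcons size_tuple ltn_ord.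
by rewrite (tnth_nth i) /= nth_rcons size_tuple ltnn eqxx.
Qed.

Lemma ler_Eblk {R : realType} {M} (p : 'I_M -> R) k X Y :
  (forall i, 0 <= p i) -> (forall s, X s <= Y s) -> Eblk p k X <= Eblk p k Y.
Proof.
move=> p0 XY; apply: ler_sum => s _; apply: ler_wpM2l => //.
by apply: prodr_ge0.
Qed.

Lemma EblkD {R : realType} {M} (p : 'I_M -> R) k X Y :
  Eblk p k (fun s => X s + Y s) = Eblk p k X + Eblk p k Y.
Proof. by rewrite -big_split; apply: eq_bigr => s _; rewrite mulrDr. Qed.

Lemma EblkZ {R : realType} {M} (p : 'I_M -> R) k c X :
  Eblk p k (fun s => c * X s) = c * Eblk p k X.
Proof. by rewrite mulr_sumr; apply: eq_bigr => s _; rewrite mulrCA. Qed.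

Lemma Eblk_cst {R : realType} {M} (p : 'I_M -> R) k c :
  \sum_i p i = 1 -> Eblk p k (fun=> c) = c.
Proof.
move=> p1; elim: k => [|k IHk]; first by rewrite Eblk0.
by rewrite Eblk_rcons -mulr_suml p1 mul1r.
Qed.

(** Nonnegativity of the variance. *)
Lemma sqr_Eblk {R : realType} {M} (p : 'I_M -> R) k X :
  (forall i, 0 <= p i) -> \sum_i p i = 1 ->
  Eblk p k X ^+ 2 <= Eblk p k (fun s => X s ^+ 2).
Proof.
move=> p0 p1; set c := Eblk p k X.
have : Eblk p k (fun=> 0) <= Eblk p k (fun s => (X s - c) ^+ 2).
  by apply: ler_Eblk => // s; rewrite sqr_ge0.
have -> : (fun s => (X s - c) ^+ 2) =
    (fun s => X s ^+ 2 + ((- (2 * c)) * X s + c ^+ 2)).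
  by apply/funext => s; ring.
by rewrite !EblkD EblkZ !Eblk_cst // -/c; lra.
Qed.

(** * The dual problem and block coordinate descent *)

(** By the chain rule, the gradient of [Psi] when [g] is that of [fconj f]; [Psi_convex] and
    [Psi_descent] express the link. *)
Definition dual_grad {R : realType} {m n} (A : 'M[R]_(m, n)) (b : 'cV[R]_m)
    (g : 'cV[R]_n -> 'cV[R]_n) (y : 'cV[R]_m) : 'cV[R]_m :=
  A *m g (A^T *m y) - b.

Definition dual_step {R : realType} {m n M} (msz : 'I_M -> nat)
    (A : 'M[R]_(m, n)) b g (y : 'cV[R]_m) (i : 'I_M) : 'cV[R]_m :=
  y - (Lblk msz A i)^-1 *:
      (Ublk R m msz i *m ((Ublk R m msz i)^T *m dual_grad A b g y)).

Definition dual_iter {R : realType} {m n M} (msz : 'I_M -> nat)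
    (A : 'M[R]_(m, n)) b g (s : seq 'I_M) : 'cV[R]_m :=
  foldl (dual_step msz A b g) 0 s.

(** Since A^T U_i is the transpose of the block A_(i), A^T maps each dual step to a step of the
    method. *)
Lemma bk_d_dual {R : realType} {m n M} (msz : 'I_M -> nat)
    (A : 'M[R]_(m, n)) b g s :
  bk_d msz A b g s = A^T *m dual_iter msz A b g s.
Proof.
elim/last_ind: s => [|s i IHs]; first by rewrite /= mulmx0.
rewrite /bk_d /dual_iter !foldl_rcons -/(bk_d msz A b g s) IHs.
rewrite -/(dual_iter msz A b g s) /bk_step /dual_step [RHS]mulmxBr -scalemxAr.
by rewrite /Ablk trmx_mul trmxK !mulmxA !mulmxBr !mulmxA.
Qed.

Lemma Psi_convex {R : realType} {m n} {f : 'cV[R]_n -> R} {g}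
    (A : 'M[R]_(m, n)) b y z :
  strongly_convex1 f -> is_gradient (fconj f) g ->
  Psi f A b y + dot (z - y) (dual_grad A b g y) <= Psi f A b z.
Proof.
move=> scf gradg; have := fconj_convex (A^T *m y) (A^T *m z) scf gradg.
rewrite -mulmxBr dot_mulmx trmxK /Psi /dual_grad (dotBr (z - y)).
by rewrite (dotC _ b) (dotBr b); lra.
Qed.

Lemma Psi_descent {R : realType} {m n} {f : 'cV[R]_n -> R} {g}
    (A : 'M[R]_(m, n)) b y h :
  strongly_convex1 f -> is_gradient (fconj f) g ->
  Psi f A b (y + h) <=
    Psi f A b y + dot h (dual_grad A b g y) + norm2 (A^T *m h) ^+ 2 / 2.
Proof.
move=> scf gradg; have := fconj_descent (A^T *m y) (A^T *m h) scf gradg.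
rewrite -mulmxDr dot_mulmx trmxK /Psi /dual_grad (dotBr h).
by rewrite (dotC _ b) (dotDr b); lra.
Qed.

(** A short step against a nonzero gradient would bring [Psi] below its minimum. *)
Lemma dual_grad_Ystar {R : realType} {m n} {f : 'cV[R]_n -> R} {g}
    (A : 'M[R]_(m, n)) b y :
  strongly_convex1 f -> is_gradient (fconj f) g -> Ystar f A b y ->
  dual_grad A b g y = 0.
Proof.
move=> scf gradg ymin; set r := dual_grad A b g y.
apply: dot_eq0; apply/le_anti; rewrite dot_ge0 andbT leNgt; apply/negP.
set N := dot r r => N0.
set Q := norm2 (A^T *m r) ^+ 2; have Q0 : 0 <= Q by rewrite sqr_ge0.
(* The added 1 covers Q = 0; s * Q <= N keeps the quadratic term within half the linear gain. *)
pose s := N / (Q + 1).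
have s0 : 0 < s by rewrite divr_gt0 //; lra.
have sQ : s * Q <= N.
  by rewrite mulrAC ler_pdivrMr; nra.
have := Psi_descent A b y (- s *: r) scf gradg.
rewrite -scalemxAr norm2Z exprMn -/Q -/r dotZl -/N => desc.
have := le_trans (ymin (y + - s *: r)) desc.
rewrite real_normK ?num_real // -addrA lerDl.
have -> : - s * N + (- s) ^+ 2 * Q / 2 = s * (s * Q / 2 - N) by ring.
by rewrite pmulr_rge0 // subr_ge0; lra.
Qed.

(** Fenchel-Young is an equality at g (A^T y), and A x = b turns dot (A^T y) x into dot y b. *)
Lemma bregman_dual {R : realType} {m n} {f : 'cV[R]_n -> R} {g}
    (A : 'M[R]_(m, n)) b x y :
  strongly_convex1 f -> is_gradient (fconj f) g -> A *m x = b ->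
  bregman f (A^T *m y) (g (A^T *m y)) x = f x + Psi f A b y.
Proof.
move=> scf gradg Ax; rewrite /Psi (fconj_grad _ scf gradg) /bregman dotBr.
by rewrite (dot_mulmx A^T y x) trmxK Ax (dotC y); lra.
Qed.

(** One inequality is Fenchel-Young. For the other, the vanishing dual gradient makes g (A^T y)
    feasible, with objective value - Psi y. *)
Lemma strong_duality {R : realType} {m n} {f : 'cV[R]_n -> R} {g}
    (A : 'M[R]_(m, n)) b x y :
  strongly_convex1 f -> is_gradient (fconj f) g -> A *m x = b ->
  (forall z, A *m z = b -> f x <= f z) -> Ystar f A b y ->
  f x = - Psi f A b y.
Proof.
move=> scf gradg Ax xmin ymin; apply/le_anti/andP; split; last first.
  have := Fenchel_Young (A^T *m y) x scf.
  by rewrite dot_mulmx trmxK Ax /Psi (dotC y); lra.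
have /eqP := dual_grad_Ystar A b y scf gradg ymin.
rewrite subr_eq0 => /eqP Az; apply: le_trans (xmin _ Az) _.
rewrite /Psi (fconj_grad _ scf gradg) (dot_mulmx A^T y) trmxK Az (dotC y).
by lra.
Qed.

Lemma half_sqr_norm2_le_bregman {R : realType} {n} {f : 'cV[R]_n -> R} {g} d x :
  strongly_convex1 f -> is_gradient (fconj f) g ->
  1 / 2 * norm2 (g d - x) ^+ 2 <= bregman f d (g d) x.
Proof.
move=> scf gradg; have := tilt_growth d x scf gradg.
by rewrite (fconj_grad _ scf gradg) /bregman dotBr; lra.
Qed.

(** The linear gain is |v|^2 / L; since |A_(i)^T v|^2 <= L |v|^2, the quadratic term costs at most
    half of it. *)
Lemma dual_step_descent {R : realType} {m n M} (msz : 'I_M -> nat)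
    {f : 'cV[R]_n -> R} {g} (A : 'M[R]_(m, n)) b y i :
  strongly_convex1 f -> is_gradient (fconj f) g -> 0 < Lblk msz A i ->
  Psi f A b (dual_step msz A b g y i) <= Psi f A b y -
    norm2 ((Ublk R m msz i)^T *m dual_grad A b g y) ^+ 2 / (2 * Lblk msz A i).
Proof.
move=> scf gradg L0; rewrite /dual_step; set U := Ublk R m msz i.
set v := U^T *m _; set L := Lblk msz A i in L0 *.
apply: le_trans (Psi_descent A b y _ scf gradg) _.
rewrite dotNl dotZl dot_mulmx -/v mulmxN norm2N -scalemxAr norm2Z exprMn.
rewrite real_normK ?num_real // mulmxA.
have -> : A^T *m U = (Ablk msz A i)^T by rewrite trmx_mul trmxK.
have : norm2 ((Ablk msz A i)^T *m v) ^+ 2 <= L * norm2 v ^+ 2.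
  rewrite /L /Lblk -exprMn ler_sqr ?nnegrE ?norm2_mulmx_tr ?norm2_ge0 //.
  by rewrite mulr_ge0 ?specnorm_ge0 ?norm2_ge0.
set W := _ ^+ 2 => WL; rewrite -sqr_norm2; set V := norm2 v ^+ 2 in WL *.
rewrite -addrA lerD2l.
have : L ^- 2 * W <= L ^- 2 * (L * V).
  by rewrite ler_wpM2l // invr_ge0 exprn_ge0 // ltW.
have -> : L ^- 2 * (L * V) = L^-1 * V by field; rewrite gt_eqF.
have -> : V / (2 * L) = L^-1 * V / 2 by field; rewrite gt_eqF.
by rewrite exprVn; lra.
Qed.

(** * The scalar recursion, block-weighted norms and the expected decrease *)

(** The induction step, used with q = k + 4. Since D a - a^2 increases up to D / 2 and a <= D / q <=
    D / 2, its value at D / q is the worst case; (q - 1)(q + 1) <= q^2 concludes. *)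
Lemma rate_step {R : realType} (D a b q : R) :
  0 <= D -> 0 <= a -> b <= a -> 2 <= q -> a <= D / q ->
  a ^+ 2 <= D * (a - b) -> b <= D / (q + 1).
Proof.
move=> D0 a0 ba q2 aq rec; have q0 : 0 < q by lra.
move: D0; rewrite le_eqVlt => /predU1P[D0|D0].
  by move: aq; rewrite -D0 !mul0r; lra.
move: aq; rewrite !ler_pdivlMr //; last by lra.
move=> aq; rewrite -(ler_pM2l (mulr_gt0 D0 (exprn_gt0 2 q0))).
pose c := a * q; pose x := D - c.
have x0 : 0 <= x by rewrite subr_ge0.
have cD : (q + 1) * (c * (D * q - c)) <= D ^+ 2 * q ^+ 2.
  have -> : c * (D * q - c) = D ^+ 2 * (q - 1) - x * D * (q - 2) - x ^+ 2.
    by rewrite /x; ring.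
  have xD : 0 <= x * D * (q - 2) by rewrite mulr_ge0 ?mulr_ge0 ?subr_ge0 // ltW.
  have := sqr_ge0 x; have := sqr_ge0 D; nra.
have qq : 0 <= q ^+ 2 * (q + 1) by rewrite mulr_ge0 ?sqr_ge0 //; lra.
have rec' : D * b <= D * a - a ^+ 2 by lra.
have := ler_wpM2l qq rec'.
have -> : q ^+ 2 * (q + 1) * (D * a - a ^+ 2) = (q + 1) * (c * (D * q - c)).
  by rewrite /c; ring.
by move: cD; nra.
Qed.

Lemma dot_blocks {R : realType} {M m} (msz : 'I_M -> nat) (x y : 'cV[R]_m) :
  (\sum_(i < M) msz i)%N = m ->
  dot x y = \sum_i dot ((Ublk R m msz i)^T *m x) ((Ublk R m msz i)^T *m y).
Proof.
move=> szm; rewrite -[y in LHS]mul1mx -(sum_Ublk msz szm) mulmx_suml dot_sumr.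
by apply: eq_bigr => i _; rewrite dot_mulmx trmxK mulmxA dotC dot_mulmx dotC
  trmx_mul trmxK.
Qed.

Lemma powR_split {R : realType} (L alpha : R) :
  0 < L -> L = L `^ alpha * L `^ (1 - alpha).
Proof.
move=> L0; rewrite -powRD; last by rewrite (gt_eqF L0) implybT.
by rewrite addrC subrK powRr1 // ltW.
Qed.

Lemma powR_div {R : realType} (L alpha : R) :
  0 < L -> L / L `^ (1 - alpha) = L `^ alpha.
Proof.
by move=> L0; rewrite {1}(powR_split _ alpha L0) mulfK // gt_eqF ?powR_gt0.
Qed.

Lemma sqr_normb {R : realType} {m n M} (msz : 'I_M -> nat) (A : 'M[R]_(m, n))
    beta y :
  normb msz A beta y ^+ 2 = \sum_(i < M) (Lblk msz A i) `^ beta *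
                          norm2 ((Ublk R m msz i)^T *m y) ^+ 2.
Proof.
rewrite sqr_sqrtr //; apply: sumr_ge0 => i _.
by rewrite mulr_ge0 ?powR_ge0 ?sqr_ge0.
Qed.

Lemma normb_ge0 {R : realType} {m n M} (msz : 'I_M -> nat) (A : 'M[R]_(m, n))
    beta y : 0 <= normb msz A beta y.
Proof. exact: sqrtr_ge0. Qed.

(* Squared norm dual to [normb msz A (1 - alpha)]. *)
Definition sqr_normb_dual {R : realType} {m n M} (msz : 'I_M -> nat)
    (A : 'M[R]_(m, n)) (alpha : R) (v : 'cV[R]_m) : R :=
  \sum_(i < M) norm2 ((Ublk R m msz i)^T *m v) ^+ 2 / (Lblk msz A i) `^ (1 - alpha).

Lemma sqr_normb_dual_ge0 {R : realType} {m n M} (msz : 'I_M -> nat)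
    (A : 'M[R]_(m, n)) (alpha : R) v : 0 <= sqr_normb_dual msz A alpha v.
Proof.
by apply: sumr_ge0 => i _; rewrite divr_ge0 ?sqr_ge0 ?powR_ge0.
Qed.

(** Cauchy-Schwarz inside each block, then across blocks with weights L_i^(1 - alpha). *)
Lemma dot_le_normb {R : realType} {m n M} (msz : 'I_M -> nat)
    (A : 'M[R]_(m, n)) (alpha : R) v h :
  (forall i, 0 < Lblk msz A i) -> (\sum_(i < M) msz i)%N = m ->
  dot v h <= Num.sqrt (sqr_normb_dual msz A alpha v) * normb msz A (1 - alpha) h.
Proof.
move=> L0 szm; rewrite (dot_blocks msz _ _ szm).
pose a i := norm2 ((Ublk R m msz i)^T *m v).
pose c i := norm2 ((Ublk R m msz i)^T *m h).
apply: (@le_trans _ _ (\sum_i a i * c i)).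
  by apply: ler_sum => i _; exact: dot_le_norm2.
have ac0 : 0 <= \sum_i a i * c i.
  by apply: sumr_ge0 => i _; rewrite mulr_ge0 ?norm2_ge0.
rewrite -ler_sqr ?nnegrE ?mulr_ge0 ?sqrtr_ge0 //.
rewrite exprMn sqr_sqrtr ?sqr_normb_dual_ge0 // sqr_normb.
by apply: weighted_Cauchy_Schwarz => i; rewrite powR_gt0.
Qed.

(** This makes [Psi] smooth for the block norm. After splitting over blocks, Cauchy-Schwarz with
    weights L_i^(1 - alpha) leaves the sum of L_i / L_i^(1 - alpha) = L_i^alpha. *)
Lemma sqr_norm2_tr_le {R : realType} {m n M} (msz : 'I_M -> nat)
    (A : 'M[R]_(m, n)) (alpha : R) h :
  (forall i, 0 < Lblk msz A i) -> (\sum_(i < M) msz i)%N = m ->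
  norm2 (A^T *m h) ^+ 2 <=
    (\sum_i (Lblk msz A i) `^ alpha) * normb msz A (1 - alpha) h ^+ 2.
Proof.
move=> L0 szm; set w := A^T *m h.
pose c i := norm2 ((Ublk R m msz i)^T *m h).
pose T := \sum_i specnorm (Ablk msz A i) * c i.
have T0 : 0 <= T.
  by apply: sumr_ge0 => i _; rewrite mulr_ge0 ?specnorm_ge0 ?norm2_ge0.
have wT : norm2 w <= T.
  have [->//|w0] := eqVneq (norm2 w) 0.
  have {}w0 : 0 < norm2 w by rewrite lt_def w0 norm2_ge0.
  rewrite -(ler_pM2r w0) -expr2 sqr_norm2 {1}/w dot_mulmx trmxK.
  rewrite (dot_blocks msz _ _ szm) mulr_suml; apply: ler_sum => i _.
  apply: le_trans (dot_le_norm2 _ _) _.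
  rewrite mulmxA -/(Ablk msz A i) -/(c i) mulrAC mulrC.
  by rewrite ler_wpM2r ?norm2_ge0 // norm2_mulmx.
apply: (@le_trans _ _ (T ^+ 2)); first by rewrite ler_sqr ?nnegrE ?norm2_ge0.
rewrite sqr_normb.
have W0 i : 0 < Lblk msz A i `^ (1 - alpha) by rewrite powR_gt0.
have := weighted_Cauchy_Schwarz _ (fun i => specnorm (Ablk msz A i)) c W0.
by under [X in _ <= X * _]eq_bigr do rewrite -/(Lblk msz A _) powR_div //.
Qed.

(** The probability L_i^alpha / S turns the factor 1 / (2 L_i) into 1 / (2 S L_i^(1 - alpha)), the
    dual norm's weight over 2 S. *)
Lemma expected_step {R : realType} {m n M} (msz : 'I_M -> nat)
    {f : 'cV[R]_n -> R} {g} (A : 'M[R]_(m, n)) b (alpha : R) y :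
  strongly_convex1 f -> is_gradient (fconj f) g ->
  (forall i, 0 < Lblk msz A i) -> \sum_i pblk msz A alpha i = 1 ->
  \sum_i pblk msz A alpha i * Psi f A b (dual_step msz A b g y i) <=
    Psi f A b y - sqr_normb_dual msz A alpha (dual_grad A b g y) /
                  (2 * \sum_i (Lblk msz A i) `^ alpha).
Proof.
move=> scf gradg L0 p1; set S := \sum_i _ `^ _.
have p0 i : 0 <= pblk msz A alpha i.
  by rewrite divr_ge0 ?powR_ge0 // sumr_ge0 // => j _; rewrite powR_ge0.
set v := dual_grad A b g y.
apply: (@le_trans _ _ (\sum_i pblk msz A alpha i * (Psi f A b y -
    norm2 ((Ublk R m msz i)^T *m v) ^+ 2 / (2 * Lblk msz A i)))).
  by apply: ler_sum => i _; rewrite ler_wpM2l // dual_step_descent.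
under eq_bigr do rewrite mulrBr.
rewrite sumrB -mulr_suml p1 mul1r lerD2l lerN2 mulr_suml; apply: ler_sum => i _.
rewrite /pblk -/S; have Li := powR_split (Lblk msz A i) alpha (L0 i).
set N := norm2 _ ^+ 2.
have S0 : S != 0.
  apply/eqP => S0; have := oner_neq0 R.
  by rewrite -p1 /pblk -mulr_suml -/S S0 mul0r eqxx.
have a0 : Lblk msz A i `^ alpha != 0 by rewrite gt_eqF // powR_gt0.
have u0 : Lblk msz A i `^ (1 - alpha) != 0 by rewrite gt_eqF // powR_gt0.
rewrite [X in _ <= _ * (_ / (2 * X))]Li le_eqVlt; apply/orP; left; apply/eqP.
by field; rewrite S0 a0 u0.
Qed.

(** * The convergence rate of the expected dual gap *)

Section Rate.
Context {R : realType} {m n M : nat} (msz : 'I_M -> nat) {f : 'cV[R]_n -> R}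
  {g : 'cV[R]_n -> 'cV[R]_n} (A : 'M[R]_(m, n)) (b : 'cV[R]_m) (alpha r : R).
Context (scf : strongly_convex1 f) (gradg : is_gradient (fconj f) g)
  (M_gt0 : (0 < M)%N) (L0 : forall i, 0 < Lblk msz A i)
  (szm : (\sum_(i < M) msz i)%N = m).
Context (yh : 'cV[R]_m) (yh_min : Ystar f A b yh).
(** Encodes that R_{1-alpha}(0) is at most r, without assuming that the extrema are attained. *)
Context (dist_le : forall y c, Psi f A b y <= Psi f A b 0 ->
  (forall z, Ystar f A b z -> c <= normb msz A (1 - alpha) (y - z)) -> c <= r).

Let S := \sum_i (Lblk msz A i) `^ alpha.
Let p := pblk msz A alpha.
Let gap y := Psi f A b y - Psi f A b yh.
Let D := 2 * S * r ^+ 2.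

Let S_gt0 : 0 < S.
Proof.
rewrite /S (bigD1 (Ordinal M_gt0)) //= ltr_wpDr ?powR_gt0 // sumr_ge0 // => i _.
exact: powR_ge0.
Qed.

Let r_ge0 : 0 <= r.
Proof. by apply: (dist_le 0) => // z _; apply: normb_ge0. Qed.

Let p_ge0 i : 0 <= p i.
Proof. by rewrite divr_ge0 ?powR_ge0 // ltW. Qed.

Let sum_p : \sum_i p i = 1.
Proof. by rewrite -mulr_suml divff // gt_eqF. Qed.

Let gap_ge0 y : 0 <= gap y.
Proof. by rewrite subr_ge0; apply: yh_min. Qed.

(** The gradient vanishes at a minimizer, so smoothness makes sqrt(2 gap 0 / S) a lower bound on the
    block norm of every minimizer, hence at most r. *)
Lemma initial_gap : gap 0 <= D / 4.
Proof.
have : Num.sqrt (2 * gap 0 / S) <= r.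
  apply: (dist_le 0) => // z z_min.
  rewrite -ler_sqr ?nnegrE ?sqrtr_ge0 ?normb_ge0 // sqr_sqrtr; last first.
    by rewrite divr_ge0 ?mulr_ge0 ?gap_ge0 // ltW.
  rewrite ler_pdivrMr // mulrC.
  have := Psi_descent A b z (0 - z) scf gradg.
  rewrite (dual_grad_Ystar A b z scf gradg z_min) dotC dot0l addr0 addrC subrK.
  have := sqr_norm2_tr_le msz A alpha (0 - z) L0 szm.
  rewrite /gap -/S; have := z_min yh; have := yh_min z; lra.
rewrite -ler_sqr ?nnegrE ?sqrtr_ge0 // sqr_sqrtr; last first.
  by rewrite divr_ge0 ?mulr_ge0 ?gap_ge0 // ltW.
by rewrite ler_pdivrMr // /D; lra.
Qed.

(** Convexity bounds the gap by the dual norm of the gradient times r, and the expected decrease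
    contains the square of that dual norm. *)
Lemma sqr_gap_le y : Psi f A b y <= Psi f A b 0 ->
  gap y ^+ 2 <= D * (gap y - \sum_i p i * gap (dual_step msz A b g y i)).
Proof.
move=> y0; set G := sqr_normb_dual msz A alpha (dual_grad A b g y).
have G0 : 0 <= G by exact: sqr_normb_dual_ge0.
have gapG z : Ystar f A b z ->
    gap y <= Num.sqrt G * normb msz A (1 - alpha) (y - z).
  move=> z_min; apply: le_trans (dot_le_normb msz A alpha _ _ L0 szm).
  have := Psi_convex A b y z scf gradg.
  rewrite dotC -[z - y]opprB dotNr /gap; have := z_min yh; have := yh_min z; lra.
have gapr : gap y <= Num.sqrt G * r.
  (* [dist_le] is applied to gap y / sqrt G, so G = 0 is treated apart. *)
  have [sG0|sG0] := eqVneq (Num.sqrt G) 0.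
    by have := gapG _ yh_min; rewrite sG0 !mul0r.
  have {}sG0 : 0 < Num.sqrt G by rewrite lt_def sG0 sqrtr_ge0.
  rewrite mulrC -ler_pdivrMr //; apply: (dist_le y) => // z z_min.
  by rewrite ler_pdivrMr // mulrC gapG.
have gap2 : gap y ^+ 2 <= G * r ^+ 2.
  by rewrite -[G]sqr_sqrtr // -exprMn ler_sqr ?nnegrE ?mulr_ge0 ?sqrtr_ge0.
apply: le_trans gap2 _.
have -> : \sum_i p i * gap (dual_step msz A b g y i) =
    \sum_i p i * Psi f A b (dual_step msz A b g y i) - Psi f A b yh.
  rewrite -[Psi f A b yh in RHS]mul1r -sum_p mulr_suml -sumrB.
  by apply: eq_bigr => i _; rewrite mulrBr.
have := expected_step msz A b alpha y scf gradg L0 sum_p.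
rewrite -/S -/G -/p; set E := \sum_i _ => E_le.
apply: (@le_trans _ _ (D * (G / (2 * S)))).
  have -> : D * (G / (2 * S)) = G * r ^+ 2 by rewrite /D; field; rewrite gt_eqF.
  by [].
apply: ler_wpM2l; last by rewrite /gap; lra.
by rewrite /D mulr_ge0 ?sqr_ge0 // mulr_ge0 // ltW.
Qed.

(** No step increases [Psi], so r controls the distance at every iterate. *)
Lemma dual_iter_level s :
  Psi f A b (dual_iter msz A b g s) <= Psi f A b 0.
Proof.
elim/last_ind: s => [|s i IHs]; first by [].
rewrite /dual_iter foldl_rcons; apply: le_trans IHs.
apply: le_trans (dual_step_descent msz A b _ i scf gradg (L0 i)) _.
by rewrite gerBl divr_ge0 ?sqr_ge0 // mulr_ge0 // ltW.
Qed.

Lemma expected_gap_rate k :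
  Eblk p k (fun s => gap (dual_iter msz A b g s)) <= D / (k%:R + 4).
Proof.
pose X s := gap (dual_iter msz A b g s).
have D0 : 0 <= D by rewrite /D mulr_ge0 ?sqr_ge0 // mulr_ge0 // ltW.
have X0 j : 0 <= Eblk p j X.
  by rewrite -(Eblk_cst p j 0 sum_p); apply: ler_Eblk => // s; apply: gap_ge0.
elim: k => [|k IHk]; first by rewrite Eblk0 add0r; exact: initial_gap.
have -> : k.+1%:R + 4 = k%:R + 4 + 1 :> R by rewrite -natr1; lra.
have XE s i : X (rcons s i) = gap (dual_step msz A b g (dual_iter msz A b g s) i).
  by rewrite /X /dual_iter foldl_rcons.
(* Jensen moves the square inside the expectation, where the one-step bound holds for each
   sequence. *)
have rec : Eblk p k X ^+ 2 <= D * (Eblk p k X - Eblk p k.+1 X).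
  apply: le_trans (sqr_Eblk p k X p_ge0 sum_p) _.
  rewrite Eblk_rcons -[- Eblk _ _ _]mulN1r -EblkZ -EblkD -EblkZ.
  apply: ler_Eblk => // s; rewrite mulN1r.
  have -> : \sum_i p i * X (rcons s i) =
      \sum_i p i * gap (dual_step msz A b g (dual_iter msz A b g s) i).
    by apply: eq_bigr => i _; rewrite XE.
  exact: sqr_gap_le (dual_iter_level s).
apply: (rate_step D (Eblk p k X)) => //.
- rewrite Eblk_rcons; apply: ler_Eblk => // s.
  rewrite -[leRHS]mul1r -sum_p mulr_suml; apply: ler_sum => i _.
  rewrite ler_wpM2l // -/(X (rcons s i)) XE lerB //.
  apply: le_trans (dual_step_descent msz A b _ i scf gradg (L0 i)) _.
  by rewrite gerBl divr_ge0 ?sqr_ge0 // mulr_ge0 // ltW.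
- by have := ler0n R k; lra.
Qed.

End Rate.

Theorem theorem1 (R : realType) (m n M : nat) (msz : 'I_M -> nat)
  (A : 'M[R]_(m, n)) (b : 'cV[R]_m) (f : 'cV[R]_n -> R)
  (gradf : 'cV[R]_n -> 'cV[R]_n) (xhat : 'cV[R]_n) (alpha : R) :
  (0 < M)%N ->
  (forall i, (0 < msz i)%N) ->
  (\sum_(i < M) msz i)%N = m ->
  (forall r : 'I_m, row r A != 0) ->
  (exists x, A *m x = b) ->
  strongly_convex1 f ->
  A *m xhat = b ->
  (forall x, A *m x = b -> f xhat <= f x) ->
  Ystar f A b !=set0 ->
  is_gradient (fconj f) gradf ->
  0 <= alpha <= 1 ->
  forall k : nat,
    let p := pblk msz A alpha in
    let dk := fun s : seq 'I_M => bk_d msz A b gradf s in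
    let xk := fun s : seq 'I_M => gradf (dk s) in
    1 / 2 * Eblk p k (fun s => norm2 (xk s - xhat) ^+ 2)
      <= Eblk p k (fun s => bregman f (dk s) (xk s) xhat)
    /\
    ((Eblk p k (fun s => bregman f (dk s) (xk s) xhat))%:E
      <= ((2 * M%:R * Lbar msz A alpha) / (k%:R + 4))%:E
         * (Rbeta msz f A b (1 - alpha) 0 * Rbeta msz f A b (1 - alpha) 0))%E.
Proof.
move=> M_gt0 sz_gt0 szm rowA _ scf Axhat xhat_min [yh yh_min] gradg _ k p dk xk.
have L0 i : 0 < Lblk msz A i by exact: Lblk_gt0.
have p_ge0 i : 0 <= p i.
  by rewrite divr_ge0 ?powR_ge0 // sumr_ge0 // => j _; rewrite powR_ge0.
split.
  rewrite -EblkZ; apply: ler_Eblk => // s.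
  exact: half_sqr_norm2_le_bregman.
have -> : (fun s => bregman f (dk s) (xk s) xhat) =
    (fun s => Psi f A b (dual_iter msz A b gradf s) - Psi f A b yh).
  apply/funext => s; rewrite /xk /dk bk_d_dual (bregman_dual A b) //.
  by rewrite (strong_duality A b _ yh scf gradg Axhat) // addrC.
set S := \sum_i (Lblk msz A i) `^ alpha.
have S_gt0 : 0 < S.
  rewrite /S (bigD1 (Ordinal M_gt0)) //= ltr_wpDr ?powR_gt0 // sumr_ge0 // => i _.
  exact: powR_ge0.
have -> : 2 * M%:R * Lbar msz A alpha = 2 * S.
  by rewrite /Lbar -/S mulrA mulfK // pnatr_eq0 -lt0n.
have k4 : 0 < k%:R + 4 :> R by have := ler0n R k; lra.
have c_gt0 : 0 < 2 * S / (k%:R + 4) by rewrite divr_gt0 // mulr_gt0.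
(* A common lower bound c is below the infimum over minimizers, itself below the supremum defining
   [Rbeta]. *)
have dist_le y c : Psi f A b y <= Psi f A b 0 ->
    (forall z, Ystar f A b z -> c <= normb msz A (1 - alpha) (y - z)) ->
    (c%:E <= Rbeta msz f A b (1 - alpha) 0)%E.
  move=> y0 cz; apply: (@le_trans _ _ (ereal_inf
      [set (normb msz A (1 - alpha) (y - yh))%:E | yh in Ystar f A b])).
    by apply: le_ereal_inf_tmp => _ [z zmin <-]; rewrite lee_fin cz.
  by apply: ereal_sup_ubound; exists y.
have R_ge0 : (0 <= Rbeta msz f A b (1 - alpha) 0)%E.
  by apply: (dist_le 0) => // z _; exact: normb_ge0.
(* Nonnegativity excludes -oo; at +oo the right-hand side is +oo since its factor is positive; a
   finite value serves as r. *)
move: dist_le R_ge0; case: Rbeta => [r| |] // dist_le _; last first.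
  by rewrite mulyy gt0_muley ?lte_fin // leey.
rewrite -!EFinM lee_fin mulrAC -expr2.
by apply: expected_gap_rate.
Qed.
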